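(* Let $w$ be an infinite word over a finite alphabet and let $q_w(n)$ denote the number of distinct recurrent factors of $w$ of length $n$. Then $q_w$ is (weakly) increasing. Furthermore, if $w$ is not eventually periodic, then $q_w$ is strictly increasing.
   Context: A factor of a word is a contiguous subword. A finite factor of an infinite word $w$ is recurrent if it occurs infinitely often in $w$. An infinite word is eventually periodic if it equals $uv$ with $u$ finite and $v$ periodic (i.e. $v_i=v_{i+k}$ for some $k\ge1$ and all $i$). *)

(* Defs.v *)
From mathcomp Require Import all_boot boolp.

Set Implicit Arguments.
Unset Strict Implicit.
Unset Printing Implicit Defensive.

Definition infinite_word (A : Type) : Type := nat -> A.

Definition occurs_at (A : Type) (w : infinite_word A) (u : seq A) (i : nat) : Prop :=
  mkseq (fun j => w (i + j)) (size u) = u.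

Definition recurrent (A : Type) (w : infinite_word A) (u : seq A) : Prop :=
  forall N : nat, exists2 i, N <= i & occurs_at w u i.

Definition nb_recurrent (A : finType) (w : infinite_word A) (n : nat) : nat :=
  #|[set u : n.-tuple A | `[< recurrent w u >]]|.

Definition periodic (A : Type) (v : infinite_word A) : Prop :=
  exists2 k, 1 <= k & forall i, v i = v (i + k).

(* The default value of nth is used exactly at the positions i >= size u. *)
Definition cat_word (A : Type) (u : seq A) (v : infinite_word A) : infinite_word A :=
  fun i => nth (v (i - size u)) u i.

Definition eventually_periodic (A : Type) (w : infinite_word A) : Prop :=
  exists (u : seq A) (v : infinite_word A), periodic v /\ w =1 cat_word u v.

(* Main.v *)
Require Import Defs.
From mathcomp Require Import all_boot.
From mathcomp Require Import boolp.

Set Implicit Arguments.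
Unset Strict Implicit.
Unset Printing Implicit Defensive.

(** There are finitely many words of length [n.+1], so past some position every
    factor of that length is recurrent.  Hence deleting the last letter maps the
    recurrent factors of length [n.+1] onto those of length [n].  If the two
    sets have the same size the map is injective: past that position a factor of
    length [n] determines the next letter, and since some factor of length [n]
    occurs there twice, [w] is eventually periodic. *)

(** As a tuple, a factor lies in a finite type when [A] is finite, which the maximum and the
    pigeonhole argument below rely on. *)
Definition factor (A : Type) (w : infinite_word A) (n i : nat) : n.-tuple A :=
  [tuple w (i + j) | j < n].

Definition tuple_prefix (A : Type) (n : nat) (t : n.+1.-tuple A) : n.-tuple A :=
  [tuple tnth t (widen_ord (leqnSn n) j) | j < n].

Section Factors.
Variables (A : Type) (w : infinite_word A).

Lemma tnth_factor n i (j : 'I_n) : tnth (factor w n i) j = w (i + j).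
Proof. by rewrite tnth_mktuple. Qed.

Lemma val_factor n i : factor w n i = mkseq (fun j => w (i + j)) n :> seq A.
Proof.
by rewrite /mkseq -val_enum_ord -map_comp.
Qed.

Lemma occurs_atE n (u : n.-tuple A) i : occurs_at w u i <-> factor w n i = u.
Proof.
rewrite /occurs_at size_tuple -val_factor; split=> [/val_inj //|-> //].
Qed.

Lemma tuple_prefix_factor n i : tuple_prefix (factor w n.+1 i) = factor w n i.
Proof. by apply: eq_from_tnth => j; rewrite !tnth_mktuple. Qed.

Lemma recurrent_tuple_prefix n (u : n.+1.-tuple A) :
  recurrent w u -> recurrent w (tuple_prefix u).
Proof.
move=> ru N; have [i leNi /occurs_atE <-] := ru N.
by exists i => //; apply/occurs_atE; rewrite tuple_prefix_factor.
Qed.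

(** Sliding both windows one step keeps them equal at the cost of one letter; [nb_recurrent_ltS]
    regains that letter through [extend]. *)
Lemma factorS_eq n i j : factor w n.+1 i = factor w n.+1 j ->
  w i = w j /\ factor w n i.+1 = factor w n j.+1.
Proof.
move=> eq_ij; have eq_w k : k < n.+1 -> w (i + k) = w (j + k).
  move=> ltkn; pose o := Ordinal ltkn.
  by have := congr1 (fun t => tnth t o) eq_ij; rewrite !tnth_factor.
split; first by have := eq_w 0 isT; rewrite !addn0.
by apply: eq_from_tnth => k; rewrite !tnth_factor !addSnnS eq_w ?ltnS.
Qed.

Lemma shift_eventually_periodic N k :
  0 < k -> (forall i, w (N + i) = w (N + i + k)) -> eventually_periodic w.
Proof.
move=> k_gt0 wP; exists (mkseq w N), (fun i => w (N + i)); split.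
  by exists k => // i; rewrite wP addnA.
move=> i; rewrite /cat_word size_mkseq; have [ltiN|leNi] := ltnP i N.
  by rewrite nth_mkseq.
by rewrite nth_default ?size_mkseq // subnKC.
Qed.

End Factors.

Section Counting.
Variables (A : finType) (w : infinite_word A).

(** A word that is not recurrent has no occurrence past some position; the maximum of these bounds
    over the finitely many words of length [n] serves for all of them. *)
Lemma eventually_recurrent n :
  exists N, forall i, N <= i -> recurrent w (factor w n i).
Proof.
have /choice[f fP] (u : n.-tuple A) :
    exists N, forall i, N <= i -> factor w n i = u -> recurrent w u.
  have [ru|/existsNP[N nru]] := pselect (recurrent w u); first by exists 0.
  exists N => i leNi ui; case: nru; exists i => //; exact/occurs_atE.
exists (\max_u f u) => i lei; apply: fP (erefl _).
exact: leq_trans (leq_bigmax _) lei.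
Qed.

Let recs n := [set u : n.-tuple A | `[< recurrent w u >]].

Lemma tuple_prefix_recurrent n : @tuple_prefix A n @: recs n.+1 = recs n.
Proof.
apply/setP=> u; rewrite inE; apply/imsetP/asboolP => [[v + ->]|ru].
  by rewrite inE => /asboolP; exact: recurrent_tuple_prefix.
(* Take an occurrence of [u] so late that the factor of length [n.+1] starting there is recurrent:
   it is the required preimage. *)
have [N recN] := eventually_recurrent n.+1.
have [i leNi /occurs_atE <-] := ru N.
exists (factor w n.+1 i); last by rewrite tuple_prefix_factor.
by rewrite inE; apply/asboolP; exact: recN.
Qed.

Lemma nb_recurrent_leS n : nb_recurrent w n <= nb_recurrent w n.+1.
Proof.
by rewrite /nb_recurrent -/(recs n) -tuple_prefix_recurrent leq_imset_card.
Qed.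

Lemma factor_repeats n N :
  exists i j, [/\ N <= i, i < j & factor w n i = factor w n j].
Proof.
(* One more starting position than there are words of length [n], for the pigeonhole principle. *)
pose f (k : 'I_#|{: n.-tuple A}|.+1) := factor w n (N + k).
have /injectivePn[k [l neq_kl eqf]] : ~~ injectiveb f.
  by apply/injectiveP => /leq_card; rewrite card_ord ltnn.
have [ltkl|ltlk|/val_inj eqkl] := ltngtP k l.
- by exists (N + k), (N + l); rewrite leq_addr ltn_add2l.
- by exists (N + l), (N + k); rewrite leq_addr ltn_add2l.
- by rewrite eqkl eqxx in neq_kl.
Qed.

Lemma nb_recurrent_ltS n :
  ~ eventually_periodic w -> nb_recurrent w n < nb_recurrent w n.+1.
Proof.
move=> not_per; rewrite ltn_neqAle nb_recurrent_leS andbT; apply/negP.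
rewrite /nb_recurrent -/(recs n) -tuple_prefix_recurrent => /imset_injP inj_prefix.
apply: not_per; have [N recN] := eventually_recurrent n.+1.
have extend i j : N <= i -> N <= j ->
    factor w n i = factor w n j -> factor w n.+1 i = factor w n.+1 j.
  move=> leNi leNj eq_ij; apply: inj_prefix; last by rewrite !tuple_prefix_factor.
    by rewrite inE; apply/asboolP; exact: recN.
  by rewrite inE; apply/asboolP; exact: recN.
have [i [j [leNi ltij eq_ij]]] := factor_repeats n N.
(* The equality propagates to the right: dropping the first letter leaves equal factors of length
   [n] one step further, and [extend] restores the last letter. *)
have eq_shift t : factor w n.+1 (i + t) = factor w n.+1 (j + t).
  have leNj := leq_trans leNi (ltnW ltij).
  elim: t => [|t /factorS_eq[_ eq_t]]; first by rewrite !addn0; exact: extend.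
  by rewrite !addnS; apply: extend => //; apply/leqW/leq_trans/leq_addr.
(* The repetition at [i] and [j] gives the period [j - i] from position [i] on. *)
apply: (@shift_eventually_periodic _ _ i (j - i)); first by rewrite subn_gt0.
move=> t; have [-> _] := factorS_eq (eq_shift t).
by rewrite addnAC subnKC // ltnW.
Qed.

End Counting.

Theorem theorem2p9 (A : finType) (w : infinite_word A) :
  {homo nb_recurrent w : m n / m <= n} /\
  (~ eventually_periodic w -> {homo nb_recurrent w : m n / m < n}).
Proof.
split=> [|not_per].
  by apply: homo_leq => // [? ? ?|n]; [exact: leq_trans | exact: nb_recurrent_leS].
apply: homo_ltn => [? ? ?|n]; [exact: ltn_trans | exact: nb_recurrent_ltS].
Qed.
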